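(* Let $A\in\mathbb{R}^{n\times n}$ be symmetric with eigenvalues $\lambda_1>\lambda_2\ge\lambda_3\ge\cdots\ge\lambda_n$ and $\lambda_1>0$, and let $f(x)=\|A-xx^\top\|_F^2$. Let $x^s\ne0$ be a strict saddle point of $f$ associated with an eigenvalue $\lambda$ of $A$ satisfying $\lambda<\max_iA_{i,i}$. Then there exists a constant $\delta_0>0$ such that, if $\|x^{(0)}-x^s\|<\delta_0$ and $x^{(1)}$ is obtained from $x^{(0)}$ by one step of the GCD-LS-LS iteration, then $f(x^{(1)})<f(x^s)$.
   Context: $\|\cdot\|_F$ is the Frobenius norm and $\|\cdot\|$ the Euclidean norm of a vector; $e_j$ is the $j$-th standard basis vector. A strict saddle point of $f$ is a point $y$ with $\nabla f(y)=0$ at which the Hessian $\nabla^2f(y)$ has a negative smallest eigenvalue. A nonzero strict saddle point $x^s$ is associated with the eigenvalue $\lambda$ when $x^s=\sqrt{\lambda}\,v$ with $\lambda$ a positive eigenvalue of $A$, $Av=\lambda v$ and $\|v\|=1$. The GCD-LS-LS iteration (greedy coordinate descent with exact line search along all coordinates) is $$x^{(\ell+1)}=x^{(\ell)}+\alpha_\ell e_{j_\ell},\qquad (\alpha_\ell,j_\ell)\in\operatorname*{arg\,min}_{\alpha\in\mathbb{R},\,1\le j\le n}f\bigl(x^{(\ell)}+\alpha e_j\bigr).$$ *)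

(* Defs.v *)
From HB Require Import structures.
From mathcomp Require Import all_boot all_order all_algebra.
From mathcomp Require Import all_classical all_reals all_analysis.
Import Order.TTheory GRing.Theory Num.Theory.
Import numFieldNormedType.Exports.

Set Implicit Arguments.
Unset Strict Implicit.
Unset Printing Implicit Defensive.

Local Open Scope classical_set_scope.
Local Open Scope ring_scope.

(* The library norm `|x| on matrices is the maximum norm, and is used below only
   through the (norm-independent) directional derivatives. *)
Definition frobenius_norm (R : realType) (m n : nat) (M : 'M[R]_(m, n)) : R :=
  Num.sqrt (\sum_(i < m) \sum_(j < n) M i j ^+ 2).

Definition euclidean_norm (R : realType) (n : nat) (x : 'cV[R]_n) : R :=
  Num.sqrt (\sum_(i < n) x i 0 ^+ 2).

Definition basis_vec (R : realType) (n : nat) (j : 'I_n) : 'cV[R]_n :=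
  delta_mx j 0.

(* 'D_v f x is a total operator; the partial derivatives are meaningful at the
   polynomial objective below. *)
Definition gradient (R : realType) (n : nat) (f : 'cV[R]_n -> R)
    (x : 'cV[R]_n) : 'cV[R]_n :=
  \col_(i < n) 'D_(basis_vec R i) f x.

Definition hessian (R : realType) (n : nat) (f : 'cV[R]_n -> R)
    (x : 'cV[R]_n) : 'M[R]_n :=
  \matrix_(i < n, j < n)
    'D_(basis_vec R i) (fun y => 'D_(basis_vec R j) f y) x.

Definition is_smallest_eigenvalue (R : realType) (n : nat) (M : 'M[R]_n)
    (mu : R) : Prop :=
  eigenvalue M mu /\ forall nu : R, eigenvalue M nu -> mu <= nu.

Definition strict_saddle (R : realType) (n : nat) (f : 'cV[R]_n -> R)
    (y : 'cV[R]_n) : Prop :=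
  gradient f y = 0 /\
  exists mu : R, is_smallest_eigenvalue (hessian f y) mu /\ mu < 0.

Definition objective (R : realType) (n : nat) (A : 'M[R]_n) (x : 'cV[R]_n) : R :=
  frobenius_norm (A - x *m x^T) ^+ 2.

(* lam 0, lam 1, ... is the list of eigenvalues with algebraic multiplicity. *)
Definition spectrum_of (R : realType) (n : nat) (A : 'M[R]_n)
    (lam : 'I_n -> R) : Prop :=
  char_poly A = \prod_(i < n) ('X - (lam i)%:P).

(* mathcomp's eigenvalue refers to row eigenvectors; the last clause
   gives the column eigenvector. *)
Definition associated_eigenvalue (R : realType) (n : nat) (A : 'M[R]_n)
    (x : 'cV[R]_n) (l : R) : Prop :=
  [/\ 0 < l, eigenvalue A l &
      exists v : 'cV[R]_n,
        [/\ A *m v = l *: v, euclidean_norm v = 1 & x = Num.sqrt l *: v]].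

Definition max_diag (R : realType) (n : nat) (A : 'M[R]_n.+1) : R :=
  \big[Num.max/A 0 0]_(i < n.+1) A i i.

Definition argmin (R : realType) (T : Type) (g : T -> R) : set T :=
  [set t | forall u : T, g t <= g u].

(* One greedy coordinate descent step with exact line search along every
   coordinate; any minimizing pair (alpha, j) may be chosen. *)
Definition gcd_ls_ls_step (R : realType) (n : nat) (f : 'cV[R]_n -> R)
    (x x' : 'cV[R]_n) : Prop :=
  exists2 p : R * 'I_n,
    argmin (fun q : R * 'I_n => f (x + q.1 *: basis_vec R q.2)) p &
    x' = x + p.1 *: basis_vec R p.2.

(* Main.v *)
Require Import Defs.
From HB Require Import structures.
From mathcomp Require Import all_boot all_order all_algebra.
From mathcomp Require Import all_classical all_reals all_analysis.
From mathcomp Require Import ring lra.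
Import Order.TTheory GRing.Theory Num.Theory.
Import numFieldNormedType.Exports.
Local Open Scope classical_set_scope.
Local Open Scope ring_scope.

(** Pick an index j with l < A_jj.  Since A xs = l xs and |xs|^2 = l, the
    linear term of the quartic polynomial t |-> f (xs + t e_j) vanishes, and
    the rest factors ([objective_along_coordinate]):
      f (xs + t e_j) - f xs = t^2 ((t + 2 xs_j)^2 - 2 (A_jj - l)).
    The second factor is negative at t = - 2 xs_j; this t already gives a
    decrease unless xs_j = 0, and in that case any small nonzero t does.  The
    decrease need not be visible in the second derivative at xs: when xs_j is
    large, e_j is a direction of positive curvature, and it is the search over
    the whole line, not only near t = 0, that escapes the saddle.

    With t and j fixed, x |-> f (x + t e_j) is continuous, so its value stays
    below f xs for every x close to xs, and the exact line search from x
    does at least as well as this particular step. *)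

Lemma sqr_frobenius_normE (R : realType) (m n : nat) (M : 'M[R]_(m, n)) :
  frobenius_norm M ^+ 2 = \sum_(i < m) \sum_(j < n) M i j ^+ 2.
Proof.
rewrite sqr_sqrtr//; apply: sumr_ge0 => i _; apply: sumr_ge0 => j _.
exact: sqr_ge0.
Qed.

Lemma objectiveE (R : realType) (n : nat) (A : 'M[R]_n) (x : 'cV[R]_n) :
  objective A x = \sum_(i < n) \sum_(j < n) (A i j - x i 0 * x j 0) ^+ 2.
Proof.
rewrite /objective sqr_frobenius_normE.
by apply: eq_bigr => i _; apply: eq_bigr => j _; rewrite !mxE big_ord1 !mxE.
Qed.

(** Along a line only the quadratic form of A and the squared length of x
    vary, so this form reduces line restrictions to scalar algebra. *)
Lemma objective_quadratic_form (R : realType) (n : nat) (A : 'M[R]_n)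
    (x : 'cV[R]_n) :
  objective A x = frobenius_norm A ^+ 2 - 2 * (x^T *m A *m x) 0 0
                  + (x^T *m x) 0 0 ^+ 2.
Proof.
have -> : (x^T *m A *m x) 0 0 = \sum_i \sum_j x i 0 * A i j * x j 0.
  rewrite mxE exchange_big; apply: eq_bigr => j _.
  rewrite mxE mulr_suml; apply: eq_bigr => i _.
  by rewrite !mxE.
have -> : (x^T *m x) 0 0 ^+ 2 = \sum_i \sum_j (x i 0 * x j 0) ^+ 2.
  rewrite mxE expr2 big_distrlr; apply: eq_bigr => i _; apply: eq_bigr => j _.
  by rewrite !mxE /=; ring.
rewrite objectiveE sqr_frobenius_normE mulr_sumr -sumrB -big_split.
apply: eq_bigr => i _; rewrite mulr_sumr -sumrB -big_split.
by apply: eq_bigr => j _ /=; ring.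
Qed.

Lemma continuous_objective (R : realType) (n : nat) (A : 'M[R]_n.+1) :
  continuous (objective A).
Proof.
have -> : objective A =
    fun x => \sum_(i < n.+1) \sum_(j < n.+1) (A i j - x i 0 * x j 0) ^+ 2.
  by apply/funext => x; rewrite objectiveE.
apply: (continuous_big (@add_continuous R)) => i _.
apply: (continuous_big (@add_continuous R)) => j _ x.
have entry_cvg k : y k 0 @[y --> x] --> x k 0 by exact: coord_continuous.
have residual_cvg : A i j - y i 0 * y j 0 @[y --> x] --> A i j - x i 0 * x j 0.
  by apply: cvgB; [exact: cvg_cst | exact: cvgM].
exact: (cvgM residual_cvg residual_cvg).
Qed.

(** Neighbourhoods of a column vector are given by the maximum norm; this
    turns a Euclidean distance bound into membership in such a neighbourhood. *)
Lemma mx_norm_le_euclidean (R : realType) (n : nat) (x : 'cV[R]_n.+1) :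
  `|x| <= euclidean_norm x.
Proof.
rewrite /Num.norm /= mx_normrE; apply: bigmax_le => [|[i k] _ /=].
  exact: sqrtr_ge0.
rewrite (ord1 k) -sqrtr_sqr ler_wsqrtr// (bigD1 i)//= lerDl.
by apply: sumr_ge0 => j _; exact: sqr_ge0.
Qed.

(** The linear term in t cancels because x is a critical point; completing
    the square in the cofactor of t^2 separates t from the gap A_jj - l. *)
Lemma objective_along_coordinate (R : realType) (n : nat) (A : 'M[R]_n)
    (x : 'cV[R]_n) (l t : R) (j : 'I_n) :
  A^T = A -> A *m x = l *: x -> (x^T *m x) 0 0 = l ->
  objective A (x + t *: basis_vec R j) =
  objective A x + t ^+ 2 * ((t + 2 * x j 0) ^+ 2 - 2 * (A j j - l)).
Proof.
move=> A_sym Ax xx; rewrite !objective_quadratic_form /basis_vec.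
set e := delta_mx j 0.
have xTA : x^T *m A = l *: x^T by rewrite -{1}A_sym -trmx_mul Ax linearZ.
have xe : (x^T *m e) 0 0 = x j 0 by rewrite -colE !mxE.
have eT : e^T = delta_mx 0 j by exact: trmx_delta.
have ex : (e^T *m x) 0 0 = x j 0 by rewrite eT -rowE !mxE.
have ee : (e^T *m e) 0 0 = 1 by rewrite eT -rowE !mxE !eqxx.
have eAe : (e^T *m A *m e) 0 0 = A j j by rewrite eT -rowE -colE !mxE.
have addE (B C : 'M[R]_1) : (B + C) 0 0 = B 0 0 + C 0 0 by rewrite mxE.
have scaleE (a : R) (B : 'M[R]_1) : (a *: B) 0 0 = a * B 0 0 by rewrite mxE.
have lineT : (x + t *: e)^T = x^T + t *: e^T.
  by apply/matrixP => i k; rewrite !mxE.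
have -> : ((x + t *: e)^T *m A *m (x + t *: e)) 0 0 =
          l * l + 2 * t * l * x j 0 + t ^+ 2 * A j j.
  rewrite lineT !mulmxDl !mulmxDr xTA -!scalemxAl -!scalemxAr.
  rewrite -(mulmxA _ A x) Ax -!scalemxAr !(addE, scaleE) xx xe ex eAe; ring.
have -> : ((x + t *: e)^T *m (x + t *: e)) 0 0 = l + 2 * t * x j 0 + t ^+ 2.
  rewrite lineT !mulmxDl !mulmxDr -!scalemxAl -!scalemxAr.
  rewrite !(addE, scaleE) xx xe ex ee; ring.
rewrite xTA -scalemxAl scaleE xx; ring.
Qed.

Theorem theorem4p1 (R : realType) (n : nat) (A : 'M[R]_n.+1)
    (lam : 'I_n.+1 -> R) (xs : 'cV[R]_n.+1) (l : R)
    (A_sym : A^T = A)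
    (lam_spectrum : spectrum_of A lam)
    (lam_sorted : forall i j : 'I_n.+1, (i <= j)%N -> lam j <= lam i)
    (lam_simple : forall i : 'I_n.+1, (0 < i)%N -> lam i < lam ord0)
    (lam1_gt0 : 0 < lam ord0)
    (xs_neq0 : xs <> 0)
    (xs_saddle : strict_saddle (objective A) xs)
    (xs_assoc : associated_eigenvalue A xs l)
    (l_lt_max : l < max_diag A) :
  exists2 delta0 : R, 0 < delta0 &
    forall x0 x1 : 'cV[R]_n.+1,
      euclidean_norm (x0 - xs) < delta0 ->
      gcd_ls_ls_step (objective A) x0 x1 ->
      objective A x1 < objective A xs.
Proof.
have [l_gt0 _ [v [Av v_unit xsE]]] := xs_assoc.
have Axs : A *m xs = l *: xs.
  by rewrite xsE -scalemxAr Av !scalerA mulrC.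
have vv : (v^T *m v) 0 0 = 1.
  rewrite mxE -(expr1n _ 2) -v_unit sqr_sqrtr.
    by apply: eq_bigr => i _; rewrite !mxE expr2.
  by apply: sumr_ge0 => i _; exact: sqr_ge0.
have xs_sqnorm : (xs^T *m xs) 0 0 = l.
  have -> : xs^T = Num.sqrt l *: v^T by rewrite xsE; exact: linearZ.
  rewrite xsE -scalemxAl -scalemxAr scalerA mxE vv mulr1.
  by rewrite -expr2 sqr_sqrtr// ltW.
have [j l_lt] : exists j, l < A j j.
  have /bigmax_gtP[] := l_lt_max.
    by exists ord0.
  by move=> [j _ ?]; exists j.
have [t descent] :
    exists t, objective A (xs + t *: basis_vec R j) < objective A xs.
  (* If xs_j = 0, the choice t^2 = A_jj - l keeps t^2 below 2 (A_jj - l). *)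
  exists (if xs j 0 == 0 then Num.sqrt (A j j - l) else - 2 * xs j 0).
  rewrite (objective_along_coordinate _ _ _ _ _ _ j A_sym Axs xs_sqnorm).
  rewrite gtrDl; case: eqP => [->|/eqP xsj].
    rewrite mulr0 addr0 sqr_sqrtr ?subr_ge0 ?ltW//.
    by rewrite pmulr_rlt0 ?subr_gt0//; lra.
  rewrite pmulr_rlt0 ?exprn_even_gt0 ?mulf_neq0 ?oppr_eq0 ?pnatr_eq0//=.
  by rewrite mulNr addNr expr0n /=; lra.
have step_cvg : objective A (y + t *: basis_vec R j) @[y --> xs] -->
                objective A (xs + t *: basis_vec R j).
  apply: (@cvg_comp _ _ _ (fun y => y + t *: basis_vec R j) (objective A)).
    by exact: (cvgD cvg_id (cvg_cst _)).
  exact: continuous_objective.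
have /nbhs_ballP[d /= d_gt0 near_xs] :
    \forall y \near xs, objective A (y + t *: basis_vec R j) < objective A xs.
  exact: (cvgr_lt _ step_cvg).
exists d => // x0 x1 x0_near [p p_min ->].
apply: le_lt_trans (p_min (t, j)) _; apply: near_xs.
rewrite -ball_normE /= distrC.
exact: le_lt_trans (mx_norm_le_euclidean _ _ _) x0_near.
Qed.
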